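(* For all $f,g:\mathbb{N}^k\to\mathbb{C}$ we have $N(f*g)=N(f)N(g)$.
   Context: $\mathbf{a}\cdot\mathbf{b}:=(a_1b_1,\ldots,a_kb_k)$ for $\mathbf{a},\mathbf{b}\in\mathbb{N}^k$; the multiple Dirichlet product is $(f*g)(\mathbf{n})=\sum_{\mathbf{a}\cdot\mathbf{b}=\mathbf{n}} f(\mathbf{a})g(\mathbf{b})$. The norm $N:\{f:\mathbb{N}^k\to\mathbb{C}\}\to\mathbb{Z}_{\ge0}$ is $N(0)=0$ and, for $f\ne0$, $N(f)=\min\{n_1\cdots n_k : \mathbf{n}\in\mathbb{N}^k,\ f(\mathbf{n})\ne0\}$. *)

(* Defs.v *)
From HB Require Import structures.
From mathcomp Require Import all_boot all_order all_algebra.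
From mathcomp Require Import boolp classical_sets functions cardinality fsbigop.
From mathcomp Require Import reals.
From mathcomp Require Export complex.

Set Implicit Arguments.
Unset Strict Implicit.
Unset Printing Implicit Defensive.

Import Order.TTheory GRing.Theory Num.Theory.

(* The arithmetic functions below live on positive integers: 0 is excluded. *)
Definition posnat : Type := {n : nat | 0 < n}.
HB.instance Definition _ := Choice.on posnat.

Lemma mulp_gt0 (a b : posnat) : 0 < val a * val b.
Proof. by rewrite muln_gt0 (valP a) (valP b). Qed.

Definition mulp (a b : posnat) : posnat := exist _ (val a * val b) (mulp_gt0 a b).

Definition posvec (k : nat) : Type := {ffun 'I_k -> posnat}.
HB.instance Definition _ (k : nat) := Choice.on (posvec k).

Definition mulv (k : nat) (a b : posvec k) : posvec k :=
  [ffun i => mulp (a i) (b i)].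

Definition prodv (k : nat) (n : posvec k) : nat := \prod_(i < k) val (n i).

Local Open Scope classical_set_scope.

Definition factorizations (k : nat) (n : posvec k) :
    set (posvec k * posvec k) :=
  [set p | mulv p.1 p.2 = n].

(* A sum over a classical set is 0 by convention when its support is infinite;
   this lemma shows that the convention plays no role in [dconv]. *)
Lemma finite_factorizations (k : nat) (n : posvec k) :
  finite_set (factorizations n).
Proof.
pose p1 : posnat := exist _ 1 isT.
pose M := \max_(i < k) val (n i).
pose F := {ffun 'I_k -> 'I_M.+1}.
pose u (a : F) : posvec k := [ffun i => insubd p1 (a i : nat)].
pose w (p : F * F) : posvec k * posvec k := (u p.1, u p.2).
apply: (@sub_finite_set _ _ (w @` [set: F * F]));
  last exact/finite_image/finite_finset.
have uK (a : posvec k) : (forall i, val (a i) <= val (n i)) ->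
    u [ffun i => inord (val (a i))] = a.
  move=> le_an; apply/ffunP => i; rewrite !ffunE inordK.
    by rewrite valKd.
  by rewrite ltnS (leq_trans (le_an i))// /M (leq_bigmax i).
move=> [a b] /= abn.
exists ([ffun i => inord (val (a i))], [ffun i => inord (val (b i))]) => //.
have abE i : val (n i) = (val (a i) * val (b i))%N by rewrite -abn ffunE.
by rewrite /w /= !uK // => i; rewrite abE ?leq_pmulr ?leq_pmull // (valP (_ i)).
Qed.

Local Open Scope ring_scope.

Definition dconv (R : realType) (k : nat) (f g : posvec k -> R[i]) :
    posvec k -> R[i] :=
  fun n => \sum_(p \in factorizations n) f p.1 * g p.2.

Definition norm_value (R : realType) (k : nat) (f : posvec k -> R[i]) :
    pred nat :=
  fun m => `[< exists2 n : posvec k, f n <> 0 & prodv n = m >].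

Lemma norm_value_ex (R : realType) (k : nat) (f : posvec k -> R[i]) :
  f <> (fun=> 0) -> exists m, norm_value f m.
Proof.
move=> fN0; have [n fn] : exists n, f n <> 0.
  by apply/existsNP => f0; apply: fN0; apply/funext.
by exists (prodv n); apply/asboolP; exists n.
Qed.

Definition dnorm (R : realType) (k : nat) (f : posvec k -> R[i]) : nat :=
  match pselect (f = (fun=> 0)) with
  | left _ => 0%N
  | right fN0 => ex_minn (norm_value_ex fN0)
  end.

(* Main.v *)
Require Import Defs.
From mathcomp Require Import all_boot all_order all_algebra.
From mathcomp Require Import reals.
From mathcomp Require Import boolp classical_sets fsbigop.

(** If [f a * g b] is nonzero then the norm of [a * b] is at least
    [N f * N g].  For equality, order the points of minimal norm in the supports
    of [f] and of [g] lexicographically and take the two least ones, [a0] and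
    [b0]: as the lexicographic order is compatible with multiplication,
    [(a0, b0)] is the only factorization contributing to [f * g] at
    [a0 * b0]. *)

Set Implicit Arguments.
Unset Strict Implicit.
Unset Printing Implicit Defensive.

Import GRing.Theory.

Lemma mulvE (k : nat) (a b : posvec k) (i : 'I_k) :
  val (mulv a b i) = (val (a i) * val (b i))%N.
Proof. by rewrite ffunE. Qed.

Lemma prodvM (k : nat) (a b : posvec k) :
  prodv (mulv a b) = (prodv a * prodv b)%N.
Proof. by rewrite /prodv -big_split; apply: eq_bigr => i _; rewrite mulvE. Qed.

Lemma prodv_gt0 (k : nat) (a : posvec k) : 0 < prodv a.
Proof. by apply: prodn_gt0 => i; apply: valP. Qed.

(** Raising either factor above its positive lower bound would raise the product. This serves twice:
    for single coordinates and for norms. *)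
Lemma muln_eq_of_leq (m n a b : nat) : 0 < m -> 0 < n ->
  m <= a -> n <= b -> a * b = m * n -> a = m /\ b = n.
Proof.
move=> m0 n0 ma nb e.
have am : a = m.
  apply/eqP; rewrite eqn_leq ma andbT -(leq_pmul2r n0) -e leq_mul2l nb.
  by rewrite orbT.
by split=> //; apply/eqP; rewrite -(eqn_pmul2l m0) -e am.
Qed.

Lemma exists_argmin (T : Type) (P : T -> Prop) (w : T -> nat) (x : T) : P x ->
  exists2 y, P y & forall z, P z -> w y <= w z.
Proof.
move=> Px.
have ex : exists m, `[< exists2 z, P z & w z = m >].
  by exists (w x); apply/asboolP; exists x.
have [m /asboolP[y Py <-] ymin] := ex_minnP ex.
by exists y => // z Pz; apply: ymin; apply/asboolP; exists z.
Qed.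

(* Minimizing the coordinates listed in [s] one after the other yields the
   lexicographically least elements of [P] and [Q]. *)
Lemma unique_product_on (k : nat) (s : seq 'I_k) (P Q : posvec k -> Prop)
    (a1 b1 : posvec k) : P a1 -> Q b1 ->
  exists a0 b0, [/\ P a0, Q b0 & forall a b, P a -> Q b ->
    mulv a b = mulv a0 b0 -> {in s, forall i, a i = a0 i /\ b i = b0 i}].
Proof.
elim: s P Q a1 b1 => [|i s IHs] P Q a1 b1 Pa1 Qb1; first by exists a1, b1.
have [a2 Pa2 a2min] := exists_argmin (fun a : posvec k => val (a i)) Pa1.
have [b2 Qb2 b2min] := exists_argmin (fun b : posvec k => val (b i)) Qb1.
(* Recurse on the elements of [P] and [Q] whose coordinate [i] is minimal. *)
have [a0 [b0 [[Pa0 a0i] [Qb0 b0i] uniq]]] :=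
  IHs (fun a => P a /\ a i = a2 i) (fun b => Q b /\ b i = b2 i) a2 b2
    (conj Pa2 erefl) (conj Qb2 erefl).
exists a0, b0; split=> // a b Pa Qb ab.
(* The product of the two minima is attained at [i], so [a] and [b] lie in the smaller sets too. *)
have [/val_inj ai /val_inj bi] : val (a i) = val (a2 i) /\ val (b i) = val (b2 i).
  apply: muln_eq_of_leq; [exact: valP | exact: valP | exact: a2min | exact: b2min |].
  by rewrite -a0i -b0i -!mulvE ab.
move=> j; rewrite inE => /predU1P[->|js]; first by rewrite a0i b0i.
exact: (uniq a b).
Qed.

Lemma unique_product (k : nat) (P Q : posvec k -> Prop) (a1 b1 : posvec k) :
  P a1 -> Q b1 ->
  exists a0 b0, [/\ P a0, Q b0 & forall a b, P a -> Q b ->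
    mulv a b = mulv a0 b0 -> a = a0 /\ b = b0].
Proof.
move=> Pa1 Qb1.
have [a0 [b0 [Pa0 Qb0 uniq]]] := unique_product_on (enum 'I_k) Pa1 Qb1.
exists a0, b0; split=> // a b Pa Qb ab.
have {}uniq i := uniq a b Pa Qb ab i (mem_enum _ i).
by split; apply/ffunP => i; have [] := uniq i.
Qed.

Section Dnorm.
Variables (R : realType) (k : nat).
Implicit Types f g : posvec k -> R[i].
Local Open Scope ring_scope.

Lemma dnorm0 : dnorm (fun _ : posvec k => 0 : R[i]) = 0%N.
Proof. by rewrite /dnorm; case: pselect. Qed.

Lemma dnorm_attained f : f <> (fun=> 0) ->
  exists2 n, f n <> 0 & prodv n = dnorm f.
Proof.
rewrite /dnorm; case: pselect => // fN0 _.
by case: ex_minnP => m /asboolP.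
Qed.

Lemma dnorm_le f n : f n <> 0 -> (dnorm f <= prodv n)%N.
Proof.
rewrite /dnorm; case: pselect => // fN0 fn.
by case: ex_minnP => m _; apply; apply/asboolP; exists n.
Qed.

Lemma dnorm_eq f n : f n <> 0 -> (forall m, f m <> 0 -> (prodv n <= prodv m)%N) ->
  dnorm f = prodv n.
Proof.
move=> fn nmin; apply/eqP; rewrite eqn_leq dnorm_le //=.
have [|m fm <-] := @dnorm_attained f; last exact: nmin.
by move=> f0; apply: fn; rewrite f0.
Qed.

Lemma dconv_neq0 f g n : dconv f g n <> 0 ->
  exists a b, [/\ mulv a b = n, f a <> 0 & g b <> 0].
Proof.
apply: contra_notP => noab; rewrite /dconv fsbig1 // => -[a b] /= abn.
apply/eqP; rewrite mulf_eq0; apply/negPn/negP => /norP[/eqP fa /eqP gb].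
by apply: noab; exists a, b.
Qed.

(** Any other factorization of [mulv a0 b0] has a factor outside the support of [f] or [g], so the
    sum collapses to a single term. *)
Lemma dconv_unique f g a0 b0 :
  (forall a b, f a <> 0 -> g b <> 0 -> mulv a b = mulv a0 b0 ->
    a = a0 /\ b = b0) ->
  dconv f g (mulv a0 b0) = f a0 * g b0.
Proof.
move=> uniq; rewrite /dconv.
rewrite -(@fsbig_widen _ _ _ _ [set (a0, b0)]%classic) ?fsbig_set1 //.
  by move=> _ ->.
move=> -[a b] [/= abn ab]; apply/eqP; rewrite mulf_eq0; apply/negPn/negP.
move=> /norP[/eqP fa /eqP gb]; apply: ab.
by have [-> ->] := uniq a b fa gb abn.
Qed.

Lemma dconv0l g : dconv (fun=> 0) g = (fun=> 0).
Proof. by apply/funext => n; apply: fsbig1 => p _; rewrite mul0r. Qed.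

Lemma dconv0r f : dconv f (fun=> 0) = (fun=> 0).
Proof. by apply/funext => n; apply: fsbig1 => p _; rewrite mulr0. Qed.

End Dnorm.

Theorem theorem2p3 (R : realType) (k : nat) (f g : posvec k -> R[i]) :
  dnorm (dconv f g) = (dnorm f * dnorm g)%N.
Proof.
(* The zero function has norm 0 by convention, not as a minimum, so it is treated apart. *)
have [->|fN0] := pselect (f = (fun=> 0%R)); first by rewrite dconv0l dnorm0.
have [->|gN0] := pselect (g = (fun=> 0%R)).
  by rewrite dconv0r dnorm0 muln0.
have [a1 fa1 a1N] := dnorm_attained fN0.
have [b1 gb1 b1N] := dnorm_attained gN0.
have [a0 [b0 [[fa0 a0N] [gb0 b0N] uniq]]] :=
  unique_product (P := fun a => f a <> 0%R /\ prodv a = dnorm f)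
    (Q := fun b => g b <> 0%R /\ prodv b = dnorm g) (conj fa1 a1N) (conj gb1 b1N).
have fg0 : dconv f g (mulv a0 b0) = (f a0 * g b0)%R.
  apply: dconv_unique => a b fa gb ab.
  (* [uniq] covers only points of minimal norm; multiplicativity of [prodv] forces [a] and [b] to be
     such points. *)
  have [aN bN] : prodv a = dnorm f /\ prodv b = dnorm g.
    apply: muln_eq_of_leq; rewrite ?dnorm_le //.
    - by rewrite -a0N prodv_gt0.
    - by rewrite -b0N prodv_gt0.
    - by rewrite -prodvM ab prodvM a0N b0N.
  exact: uniq.
rewrite -a0N -b0N -prodvM; apply: dnorm_eq.
  by rewrite fg0 => /eqP; rewrite mulf_eq0 => /orP[] /eqP.
(* Lower bound: a point where the convolution is nonzero is a product of support points of [f] and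
   [g]. *)
move=> n /dconv_neq0[a [b [<- fa gb]]].
by rewrite !prodvM a0N b0N leq_mul ?dnorm_le.
Qed.
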